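(* Let $c\in\left(1,\frac12\sqrt{\sqrt{17}+1}\right)$ and suppose that the kernel $K(t,u,v)$ satisfies $$\max_{(t,u,v)\in[0,1]^3}K(t,u,v)<c\min_{(t,u,v)\in[0,1]^3}K(t,u,v).$$ Then the operator $\mathcal{L}$ has a unique fixed point in $C_0^+[0,1]$.
   Context: Let $C^+[0,1]=\{f\in C[0,1]: f(x)\ge 0 \text{ for all } x\in[0,1]\}$ and $C_0^+[0,1]=C^+[0,1]\setminus\{\theta\}$, where $\theta\equiv 0$. Let $\xi_1:[0,1]^3\to\mathbb{R}$ and $\xi_2,\xi_3:[0,1]^2\to\mathbb{R}$ be bounded measurable functions, let $J_3,J,J_1,\alpha\in\mathbb{R}$ with $J_3\ne0$, let $\beta>0$, and let $$K(t,u,v)=\exp\{J_3\beta\xi_1(t,u,v)+J\beta\xi_2(u,v)+J_1\beta(\xi_3(t,u)+\xi_3(t,v))+\alpha\beta(u+v)\},\quad (t,u,v)\in[0,1]^3,$$ which is assumed to be continuous on $[0,1]^3$ (and is strictly positive). The Lyapunov integral operator $\mathcal{L}$ on $C[0,1]$ is $$(\mathcal{L}f)(t)=\int_0^1\int_0^1K(t,s,u)f(s)f(u)\,ds\,du.$$ *)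

(* Defs.v *)
From HB Require Import structures.
From mathcomp Require Import all_boot all_order all_algebra.
From mathcomp Require Import all_classical all_reals all_analysis.
From mathcomp Require Import measurable_realfun.
Import Order.TTheory GRing.Theory Num.Theory.
Import numFieldNormedType.Exports.

Set Implicit Arguments.
Unset Strict Implicit.
Unset Printing Implicit Defensive.

Local Open Scope classical_set_scope.
Local Open Scope ring_scope.

Definition I01 {R : realType} : set R := `[0, 1].
Definition square {R : realType} : set (R * R) := I01 `*` I01.
Definition cube {R : realType} : set (R * R * R) := square `*` I01.

(* Two- and three-dimensional Lebesgue measure (on Borel sets). *)
Definition lebesgue2 {R : realType} : set (R * R) -> \bar R :=
  (@lebesgue_measure R \x @lebesgue_measure R)%E.
Definition lebesgue3 {R : realType} : set (R * R * R) -> \bar R :=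
  ((@lebesgue_measure R \x @lebesgue_measure R) \x @lebesgue_measure R)%E.

(* Measurability with respect to the completion of mu. For mu the n-dimensional
   Lebesgue measure this is Lebesgue measurability; it is implied by (Borel)
   measurable_fun D f, so that both readings of "measurable" are covered. *)
Definition completed_measurable_fun d (T : measurableType d) (R : realType)
    (mu : set T -> \bar R) (D : set T) (f : T -> R) : Prop :=
  forall B : set R, measurable B ->
    completed_algebra_gen mu (D `&` f @^-1` B).

(* The point (t, u, v) of R^3 is encoded as the left-nested pair ((t, u), v).
   The functions are total on R^2, R^3; only their values on the unit square
   and the unit cube matter. *)
Definition kernelK (R : realType) (J3 J J1 alpha beta : R)
    (xi1 : R * R * R -> R) (xi2 xi3 : R * R -> R) (p : R * R * R) : R :=
  let: (t, u, v) := p in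
  expR (J3 * beta * xi1 (t, u, v) + J * beta * xi2 (u, v)
        + J1 * beta * (xi3 (t, u) + xi3 (t, v)) + alpha * beta * (u + v)).

Definition lyapunov (R : realType) (K : R * R * R -> R) (f : R -> R) (t : R) : R :=
  \int[@lebesgue_measure R]_(u in I01)
    \int[@lebesgue_measure R]_(s in I01) (K (t, s, u) * f s * f u).

(* An element of C[0,1] is represented by a total function R -> R which is
   continuous on [0,1] for the subspace topology; its values outside [0,1] are
   irrelevant, and two representatives are identified when they agree on [0,1]. *)
Definition C01 {R : realType} : set (R -> R) :=
  [set f | {within I01, continuous f}].

Definition C01_nonneg {R : realType} : set (R -> R) :=
  [set f | C01 f /\ forall x, I01 x -> 0 <= f x].

Definition C01_nonneg_nonzero {R : realType} : set (R -> R) :=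
  [set f | C01_nonneg f /\ ~ (forall x, I01 x -> f x = 0)].

Definition lyapunov_fixed (R : realType) (K : R * R * R -> R) (f : R -> R) : Prop :=
  forall t, I01 t -> lyapunov K f t = f t.

(* Main.v *)
(** The operator is quadratic, so a nonzero nonnegative fixed point f corresponds
    to the density h = f / ∫f, which is fixed by the normalized operator
    N h = Lh / ∫Lh; conversely h / ∫Lh is a fixed point of L.  Write m and M for the
    extrema of K.  For two densities f, g the function f - g has mean zero, so K may
    be replaced by K - m, which takes values in [0, M - m]; hence
    |Lf - Lg| <= 2 (M - m) |f - g| in the sup norm, and N is Lipschitz with constant
    2 (M - m)(M + m) / m^2 = 2 ((M/m)^2 - 1).  This is less than 1 as soon as
    c^2 < 3/2, while the hypothesis on c gives c^2 < (sqrt 17 + 1)/4 < 3/2. *)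
Require Import Defs.
From mathcomp Require Import all_boot all_order all_algebra.
From mathcomp Require Import all_classical all_reals all_analysis.
From mathcomp Require Import measurable_realfun.
From mathcomp Require Import ring lra.
Import Order.TTheory GRing.Theory Num.Theory.
Import numFieldNormedType.Exports.
Local Open Scope classical_set_scope.
Local Open Scope ring_scope.

(** * Integration over the unit interval *)

Definition int01 {R : realType} (f : R -> R) : R :=
  \int[@lebesgue_measure R]_(x in I01) f x.

Section Integral01.
Context {R : realType}.
Implicit Types f g h a e : R -> R.

Lemma measurable_I01 : measurable (@I01 R).
Proof. exact: measurable_itv. Qed.

Lemma continuous_integrable01 {f} : continuous f ->
  (@lebesgue_measure R).-integrable I01 (EFin \o f).
Proof.
move=> cf; apply: continuous_compact_integrable; first exact: segment_compact.
exact: continuous_subspaceT.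
Qed.

Lemma int01D f g : continuous f -> continuous g ->
  int01 (fun x => f x + g x) = int01 f + int01 g.
Proof.
by move=> cf cg; apply: RintegralD; [exact: measurable_I01|
  exact: continuous_integrable01..].
Qed.

Lemma int01B f g : continuous f -> continuous g ->
  int01 (fun x => f x - g x) = int01 f - int01 g.
Proof.
by move=> cf cg; apply: RintegralB; [exact: measurable_I01|
  exact: continuous_integrable01..].
Qed.

Lemma int01Zl c f : continuous f -> int01 (fun x => c * f x) = c * int01 f.
Proof.
by move=> cf; apply: RintegralZl; [exact: measurable_I01|
  exact: continuous_integrable01].
Qed.

Lemma int01Zr c f : continuous f -> int01 (fun x => f x * c) = int01 f * c.
Proof.
by move=> cf; apply: RintegralZr; [exact: measurable_I01|
  exact: continuous_integrable01].
Qed.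

Lemma int01_cst c : int01 (fun=> c : R) = c.
Proof.
have I1 : @lebesgue_measure R I01 = 1%E.
  by rewrite /I01 lebesgue_measure_itv /= lte_fin ltr01 -EFinB subr0.
rewrite /int01 Rintegral_cst; last exact: measurable_I01.
rewrite -[RHS]mulr1.
by congr (_ * _); exact: (congr1 fine I1).
Qed.

Lemma le_int01 f g : continuous f -> continuous g ->
  (forall x, I01 x -> f x <= g x) -> int01 f <= int01 g.
Proof.
by move=> cf cg fg; apply: le_Rintegral => //; [exact: measurable_I01|
  exact: continuous_integrable01..].
Qed.

Lemma eq_int01 f g : (forall x, I01 x -> f x = g x) -> int01 f = int01 g.
Proof. by move=> fg; apply: eq_Rintegral => x /set_mem /fg. Qed.

Lemma le_norm_int01 f d : continuous f -> (forall x, `|f x| <= d) ->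
  `|int01 f| <= d.
Proof.
move=> cf fd; rewrite ler_norml; apply/andP; split.
  rewrite -[leLHS]int01_cst; apply: le_int01 => //; first exact: cst_continuous.
  by move=> x _; have := fd x; rewrite ler_norml => /andP[].
rewrite -[leRHS]int01_cst; apply: le_int01 => //; first exact: cst_continuous.
by move=> x _; have := fd x; rewrite ler_norml => /andP[].
Qed.

(** Dominated convergence: the bound [g] is uniform in [t], so continuity in [t] for each fixed [s]
    passes to the integral. *)
Lemma continuous_int01_param (F : R -> R -> R) g :
  (forall t, continuous (F t)) -> (forall s, continuous (F ^~ s)) ->
  continuous g -> (forall t s, `|F t s| <= g s) ->
  continuous (fun t => int01 (F t)).
Proof.
move=> cF2 cF1 cg Fg t.
(* The domination is global, so any open interval around [t] would serve. *)
apply: (@continuity_under_integral R _ _ lebesgue_measure F I01 _ (t - 1) (t + 1) _ _ g).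
- exact: measurable_I01.
- by move=> x _; exact: continuous_integrable01.
- by apply: aeW => s _ x _; exact: cF1.
- exact: continuous_integrable01.
- by move=> x _; apply: aeW => s _; exact: Fg.
- by apply/mem_set; rewrite /= in_itv /=; apply/andP; split; lra.
Qed.

(* As e has mean zero, a may be replaced by a - lo. *)
Lemma norm_int01_mean0_le a e lo hi d : continuous a -> continuous e ->
  (forall x, lo <= a x <= hi) -> int01 e = 0 -> (forall x, `|e x| <= d) ->
  `|int01 (fun x => e x * a x)| <= (hi - lo) * d.
Proof.
move=> ca ce ab e0 ed.
have -> : int01 (fun x => e x * a x) = int01 (fun x => e x * (a x - lo)).
  have -> : (fun x => e x * (a x - lo)) = (fun x => e x * a x - e x * lo).
    by apply/funext => x; rewrite mulrBr.
  rewrite int01B ?int01Zr ?e0 ?mul0r ?subr0//.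
    by move=> x; apply: cvgM; [exact: ce|exact: ca].
  by move=> x; apply: cvgM; [exact: ce|exact: cvg_cst].
apply: le_norm_int01.
  move=> x; apply: cvgM; first exact: ce.
  by apply: cvgB; [exact: ca|exact: cvg_cst].
move=> x; rewrite normrM mulrC; have /andP[l u] := ab x.
by apply: ler_pM => //; rewrite ger0_norm; lra.
Qed.

(** Two cases matter below: mass 1, where a weighted average stays between the bounds, and mass 0,
    where the weighted integral must vanish. *)
Lemma int01_weighted_bounds a h lo hi : continuous a -> continuous h ->
  (forall x, 0 <= h x) -> (forall x, lo <= a x <= hi) ->
  lo * int01 h <= int01 (fun x => h x * a x) <= hi * int01 h.
Proof.
move=> ca ch h0 ab.
have cha : continuous (fun x => h x * a x).
  by move=> x; apply: cvgM; [exact: ch|exact: ca].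
have cZ c : continuous (fun x => c * h x).
  by move=> x; apply: cvgM; [exact: cvg_cst|exact: ch].
rewrite -!int01Zl//; apply/andP; split; apply: le_int01 => // x _;
  have /andP[l u] := ab x; rewrite [_ * h x]mulrC; exact: ler_wpM2l.
Qed.

End Integral01.

(** * Geometric error bounds and limits *)

Section Geometric.
Context {R : realType}.
Implicit Types q D x : R.

(** Applied with [x] a distance, this turns an error bound valid for every n into an equality. *)
Lemma le0_geometric q D x : 0 <= q < 1 -> (forall n, x <= D * q ^+ n) -> x <= 0.
Proof.
move=> /andP[q0 q1] xD.
have cD : (fun n => D * q ^+ n) @ \oo --> (0 : R).
  rewrite -(mulr0 D); apply: cvgM; first exact: cvg_cst.
  by apply: cvg_expr; rewrite ger0_norm.
have lim0 := cvg_lim (@Rhausdorff R) cD.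
by rewrite -lim0; apply: limr_ge; [apply/cvg_ex; exists 0|exact: nearW].
Qed.

(* The sequence u_n + D q^n is nonincreasing and bounded below by every
   u_n - D q^n, so its infimum is the limit of u. *)
Lemma geometric_inf_limit (u : nat -> R) q D : 0 <= q < 1 ->
  (forall n, `|u n.+1 - u n| <= D * (1 - q) * q ^+ n) ->
  forall n, `|inf (range (fun i => u i + D * q ^+ i)) - u n| <= D * q ^+ n.
Proof.
move=> /andP[q0 q1] du.
(* The factor [1 - q] makes the step bound equal to D q^n - D q^(n+1), so the intervals of radius D
   q^n around u_n are nested. *)
have step n : u n.+1 + D * q ^+ n.+1 <= u n + D * q ^+ n /\
    u n - D * q ^+ n <= u n.+1 - D * q ^+ n.+1.
  have := du n; rewrite ler_norml exprS => /andP[? ?].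
  by split; lra.
have hi m n : u (m + n)%N + D * q ^+ (m + n) <= u m + D * q ^+ m.
  elim: n => [|n IH]; first by rewrite addn0.
  by rewrite addnS; apply: le_trans IH; have [] := step (m + n)%N.
have lo m n : u m - D * q ^+ m <= u (m + n)%N - D * q ^+ (m + n).
  elim: n => [|n IH]; first by rewrite addn0.
  by rewrite addnS; apply: (le_trans IH); have [] := step (m + n)%N.
have D0 : 0 <= D.
  have := le_trans (normr_ge0 _) (du 0%N); rewrite expr0 mulr1.
  by rewrite pmulr_lge0// subr_gt0.
have Dq n : 0 <= D * q ^+ n by rewrite mulr_ge0// exprn_ge0.
have lohi m n : u m - D * q ^+ m <= u n + D * q ^+ n.
  have := lo m n; have := hi n m; rewrite addnC; have := Dq (m + n)%N.
  by lra.
move=> n; rewrite ler_norml; apply/andP; split.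
  rewrite lerBrDl; apply: lb_le_inf; first by exists (u 0%N + D * q ^+ 0), 0%N.
  by move=> _ [m _ <-]; exact: lohi.
rewrite lerBlDl; apply: ge_inf; last by exists n.
by exists (u 0%N - D * q ^+ 0) => _ [m _ <-]; exact: lohi.
Qed.

(** The error bound is uniform in [t], so this is the usual eps/3 argument for a uniform limit. *)
Lemma continuous_geometric_limit (f : nat -> R -> R) (l : R -> R) q D :
  0 <= q < 1 -> (forall n, continuous (f n)) ->
  (forall n t, `|l t - f n t| <= D * q ^+ n) -> continuous l.
Proof.
move=> q01 cf lf t; apply/cvgrPdist_lt => eps eps0.
(* If no such n existed, eps/3 would lie below every D q^n and hence be nonpositive. *)
have [n Dn] : exists n, D * q ^+ n < eps / 3.
  apply: contrapT => /forallNP nD.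
  have : eps / 3 <= 0.
    by apply: (le0_geometric _ D _ q01) => n; rewrite leNgt; apply/negP.
  by lra.
have /cvgrPdist_lt/(_ (eps / 3)) := cf n t.
move=> /(_ (divr_gt0 eps0 (ltr0n _ 3))) near_t.
near=> x.
have fx : `|f n t - f n x| < eps / 3 by near: x.
have lt := lf n t; have lx := lf n x.
have -> : l t - l x = (l t - f n t) + (f n t - f n x) - (l x - f n x) by ring.
apply: le_lt_trans (ler_normB _ _) _.
apply: le_lt_trans (lerD (ler_normD _ _) (lexx _)) _.
lra.
Unshelve. all: by end_near. Qed.

End Geometric.

(** * The quadratic operator of a continuous kernel with values in [m, M] *)

Section QuadraticOperator.
Context {R : realType}.
Variables (k : R -> R -> R -> R) (m M : R).
Hypothesis k_cont1 : forall s u, continuous (fun t => k t s u).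
Hypothesis k_cont2 : forall t u, continuous (fun s => k t s u).
Hypothesis k_cont3 : forall t s, continuous (k t s).
Hypothesis m_gt0 : 0 < m.
Hypothesis k_bounds : forall t s u, m <= k t s u <= M.
Implicit Types (f g h : R -> R) (d : R).

Definition inner_int f t u := int01 (fun s => f s * k t s u).
Definition quad f t := int01 (fun u => f u * inner_int f t u).
Definition normalized f t := quad f t / int01 (quad f).
(** Continuity and sign are imposed on the whole line although the mass is taken over [0,1]:
    sup-norm estimates then hold at every real point and fixed points are equal as functions. *)
Definition density f := [/\ continuous f, forall t, 0 <= f t & int01 f = 1].

Lemma m_le_M : m <= M.
Proof. by have /andP[] := k_bounds 0 0 0; exact: le_trans. Qed.

Lemma M_gt0 : 0 < M.
Proof. exact: lt_le_trans m_le_M. Qed.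

(** Provides the dominating function for continuity of the inner integral in either parameter. *)
Lemma norm_weighted_k f t s u : `|f s * k t s u| <= `|f s| * M.
Proof.
have /andP[l h] := k_bounds t s u; rewrite normrM ler_wpM2l//.
by rewrite ger0_norm// (le_trans (ltW m_gt0)).
Qed.

Lemma continuous_weighted_k2 f t u : continuous f ->
  continuous (fun s => f s * k t s u).
Proof. by move=> cf s; apply: cvgM; [exact: cf|exact: k_cont2]. Qed.

Lemma continuous_normM f c : continuous f -> continuous (fun s => `|f s| * c).
Proof.
move=> cf s; apply: cvgM; last exact: cvg_cst.
by apply: cvg_norm; exact: cf.
Qed.

Lemma continuous_inner_int1 f u : continuous f ->
  continuous (inner_int f ^~ u).
Proof.
move=> cf; apply: (@continuous_int01_param _ (fun t s => f s * k t s u)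
  (fun s => `|f s| * M)) => //.
- by move=> t; exact: continuous_weighted_k2.
- by move=> s t; apply: cvgM; [exact: cvg_cst|exact: k_cont1].
- exact: continuous_normM.
- by move=> t s; exact: norm_weighted_k.
Qed.

Lemma continuous_inner_int2 f t : continuous f -> continuous (inner_int f t).
Proof.
move=> cf; apply: (@continuous_int01_param _ (fun u s => f s * k t s u)
  (fun s => `|f s| * M)) => //.
- by move=> u; exact: continuous_weighted_k2.
- by move=> s u; apply: cvgM; [exact: cvg_cst|exact: k_cont3].
- exact: continuous_normM.
- by move=> u s; exact: norm_weighted_k.
Qed.

Lemma inner_int_bounds f t u : density f -> m <= inner_int f t u <= M.
Proof.
move=> [cf f0 f1]; have := int01_weighted_bounds (fun s => k t s u) f m M.
by rewrite f1 !mulr1; apply.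
Qed.

Lemma continuous_quad_integrand f t : continuous f ->
  continuous (fun u => f u * inner_int f t u).
Proof.
by move=> cf u; apply: cvgM; [exact: cf|exact: continuous_inner_int2].
Qed.

Lemma quad_bounds f t : density f -> m <= quad f t <= M.
Proof.
move=> df; have [cf f0 f1] := df.
have := int01_weighted_bounds (inner_int f t) f m M.
rewrite f1 !mulr1; apply => //; first exact: continuous_inner_int2.
by move=> u; exact: inner_int_bounds.
Qed.

Lemma continuous_quad f : density f -> continuous (quad f).
Proof.
move=> df; have [cf f0 f1] := df.
apply: (@continuous_int01_param _ (fun t u => f u * inner_int f t u)
  (fun u => `|f u| * M)) => //.
- by move=> t; exact: continuous_quad_integrand.
- by move=> u t; apply: cvgM; [exact: cvg_cst|exact: continuous_inner_int1].
- exact: continuous_normM.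
- move=> t u; rewrite normrM ler_wpM2l//.
  have /andP[l h] := inner_int_bounds f t u df.
  by rewrite ger0_norm// (le_trans (ltW m_gt0)).
Qed.

Lemma int01_quad_bounds f : density f -> m <= int01 (quad f) <= M.
Proof.
move=> df; have cq := continuous_quad _ df.
have cc (c : R) : continuous (fun _ : R => c) by move=> ?; exact: cvg_cst.
rewrite -[X in X <= _ <= _]int01_cst -[X in _ <= _ <= X]int01_cst.
apply/andP; split; apply: le_int01 => // t _;
  by have /andP[] := quad_bounds f t df.
Qed.

(* Polarization: f(s)f(u) - g(s)g(u) = f(u)(f - g)(s) + (f - g)(u)g(s), where
   f - g has mean zero. *)
Lemma quad_lipschitz f g d : density f -> density g ->
  (forall t, `|f t - g t| <= d) ->
  forall t, `|quad f t - quad g t| <= 2 * ((M - m) * d).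
Proof.
move=> df dg fgd t; have [cf f0 f1] := df; have [cg g0 g1] := dg.
have cfg : continuous (fun x => f x - g x).
  by move=> x; apply: cvgB; [exact: cf|exact: cg].
have fg0 : int01 (fun x => f x - g x) = 0 by rewrite int01B// f1 g1 subrr.
have inner_diff u : `|inner_int f t u - inner_int g t u| <= (M - m) * d.
  rewrite -int01B; [|exact: continuous_weighted_k2..].
  under [fun _ => _]funext => s do rewrite -mulrBl.
  by apply: norm_int01_mean0_le.
pose b u := inner_int f t u - inner_int g t u.
have cb : continuous b.
  by move=> u; apply: cvgB; exact: continuous_inner_int2.
have -> : quad f t - quad g t =
    int01 (fun u => f u * b u) + int01 (fun u => (f u - g u) * inner_int g t u).
  rewrite -int01B; [|exact: continuous_quad_integrand..].
  rewrite -int01D.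
  - by congr int01; apply/funext => u; rewrite /b; ring.
  - by move=> u; apply: cvgM; [exact: cf|exact: cb].
  - by move=> u; apply: cvgM; [exact: cfg|exact: continuous_inner_int2].
(* Each summand costs (M - m) d: the first is an average of [b] against the density [f], the second
   pairs the mean-zero [f - g] with a function valued in [m, M]. *)
rewrite [2 * _]mulr_natl mulr2n; apply: (le_trans (ler_normD _ _)); apply: lerD.
  have bb u : - ((M - m) * d) <= b u <= (M - m) * d.
    by rewrite -ler_norml; exact: inner_diff.
  have := int01_weighted_bounds b f _ _ cb cf f0 bb.
  by rewrite f1 !mulr1 ler_norml.
apply: norm_int01_mean0_le => //; first exact: continuous_inner_int2.
by move=> u; exact: inner_int_bounds.
Qed.

(** * Lipschitz estimate for the normalized operator *)

Lemma density_normalized f : density f -> density (normalized f).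
Proof.
move=> df; have cq := continuous_quad _ df.
have /andP[I0 _] := int01_quad_bounds _ df.
split.
- by move=> t; apply: cvgM; [exact: cq|exact: cvg_cst].
- move=> t; have /andP[q0 _] := quad_bounds f t df.
  by rewrite divr_ge0// (le_trans (ltW m_gt0)).
- by rewrite int01Zr// divff// gt_eqF// (lt_le_trans m_gt0).
Qed.

Definition contraction_factor := 2 * (M - m) * (M + m) / m ^+ 2.
Local Notation q := contraction_factor.

Lemma contraction_factor_ge0 : 0 <= q.
Proof.
by rewrite divr_ge0 ?exprn_ge0// ?(ltW m_gt0)// !mulr_ge0 ?subr_ge0 ?m_le_M//
  addr_ge0 ?ltW ?M_gt0.
Qed.

(** Numerators and denominators of the two quotients each differ by at most E = 2 (M - m) d, the
    denominators are at least m and [quad g t] is at most M. The difference is thus at most E/m +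
    (M/m)(E/m), which is q d. *)
Lemma normalized_contraction f g d : density f -> density g ->
  (forall t, `|f t - g t| <= d) ->
  forall t, `|normalized f t - normalized g t| <= q * d.
Proof.
move=> df dg fgd t; have D := quad_lipschitz _ _ _ df dg fgd.
set E := 2 * ((M - m) * d) in D.
have DI : `|int01 (quad f) - int01 (quad g)| <= E.
  rewrite -int01B; [|exact: continuous_quad..].
  apply: le_norm_int01 => // x.
  by apply: cvgB; exact: continuous_quad.
have /andP[a0 _] := int01_quad_bounds _ df.
have /andP[b0 _] := int01_quad_bounds _ dg.
have /andP[g0 gM] := quad_bounds _ t dg.
rewrite /normalized.
move: (int01 (quad f)) (int01 (quad g)) a0 b0 DI => a b a0 b0 DI.
have a_gt0 := lt_le_trans m_gt0 a0; have b_gt0 := lt_le_trans m_gt0 b0.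
have -> : quad f t / a - quad g t / b =
    (quad f t - quad g t) / a - quad g t / b * ((a - b) / a).
  by field; rewrite !gt_eqF.
have -> : q * d = E / m + M / m * (E / m).
  by rewrite /E /q; field; rewrite gt_eqF.
have inv x : m <= x -> x^-1 <= m^-1.
  by move=> mx; rewrite lef_pV2// posrE// (lt_le_trans m_gt0).
apply: (le_trans (ler_normB _ _)); apply: lerD.
  rewrite normrM [`|a^-1|]gtr0_norm ?invr_gt0//.
  by apply: ler_pM => //; [rewrite invr_ge0 ltW|exact: inv].
rewrite !normrM.
have [-> ->] : `|a^-1| = a^-1 /\ `|b^-1| = b^-1.
  by rewrite !gtr0_norm ?invr_gt0.
have -> : `|quad g t| = quad g t by rewrite ger0_norm// (le_trans (ltW m_gt0)).
have q0 := le_trans (ltW m_gt0) g0.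
have [ai bi] : 0 <= a^-1 /\ 0 <= b^-1 by rewrite !invr_ge0 !ltW.
by apply: ler_pM; rewrite ?mulr_ge0//; apply: ler_pM => //; exact: inv.
Qed.

(** A bound common to all densities, which starts the inductions on the number of iterations. *)
Lemma normalized_bounds f t : density f -> 0 <= normalized f t <= M / m.
Proof.
move=> df; have /andP[q0 qM] := quad_bounds f t df.
have /andP[I0 _] := int01_quad_bounds _ df.
have I_gt0 := lt_le_trans m_gt0 I0.
have {}q0 := le_trans (ltW m_gt0) q0.
rewrite divr_ge0 ?(ltW I_gt0)//=.
by apply: ler_pM; rewrite ?invr_ge0 ?(ltW I_gt0)// lef_pV2// posrE.
Qed.

(** * The fixed density of the normalized operator *)

Hypothesis q_lt1 : q < 1.

Let q01 : 0 <= q < 1. Proof. by rewrite contraction_factor_ge0 q_lt1. Qed.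

(** Two fixed densities take values in [0, M/m], so they differ by at most M/m; n applications of
    the contraction improve this to (M/m) q^n. *)
Lemma normalized_fixed_unique f g : density f -> density g ->
  normalized f = f -> normalized g = g -> f = g.
Proof.
move=> df dg ff gg; apply/funext => t; apply/eqP.
rewrite -subr_eq0 -normr_le0; apply: (le0_geometric q (M / m) _ q01) => n.
elim: n t => [|n IH] t.
  rewrite expr0 mulr1 -ff -gg ler_norml.
  move: (normalized_bounds f t df) (normalized_bounds g t dg).
  move: (normalized f t) (normalized g t) => a b /andP[? ?] /andP[? ?].
  by apply/andP; split; lra.
rewrite -ff -gg exprS mulrCA; exact: normalized_contraction.
Qed.

(** Picard iteration from the constant density 1. The limit is formed pointwise as an infimum, with
    an error D q^n uniform in [t]. *)
Lemma normalized_fixed_exists : exists2 h, density h & normalized h = h.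
Proof.
pose u n := iter n normalized (fun=> 1).
have du n : density (u n.+1) /\ density (u n).
  elim: n => [|n [IH _]].
    suff d0 : density (fun=> 1 : R) by split=> //; exact: density_normalized.
    by split=> [t|//|]; [exact: cvg_cst|exact: int01_cst].
  by split; [exact: density_normalized|exact: IH].
(* Chosen so that D (1 - q) = M/m + 1, which bounds the first step: u_1 lies in [0, M/m] and u_0 is
   1. *)
pose D := (M / m + 1) / (1 - q).
have DE : D * (1 - q) = M / m + 1 by rewrite /D divfK// gt_eqF// subr_gt0.
have D0 : 0 <= D.
  rewrite divr_ge0 ?subr_ge0 ?ltW//.
  by rewrite addr_gt0// divr_gt0// M_gt0.
have step n t : `|u n.+1 t - u n t| <= D * (1 - q) * q ^+ n.
  rewrite DE; elim: n t => [|n IH] t.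
    have := normalized_bounds _ t (du 0%N).2; rewrite -[normalized _]/(u 1%N).
    rewrite expr0 mulr1 ler_norml -[u 0%N t]/1; move: (u 1%N t) => a /andP[? ?].
    by apply/andP; split; lra.
  rewrite exprS mulrCA; apply: normalized_contraction => //.
  - exact: (du n).1.
  - exact: (du n).2.
pose h t := inf (range (fun i => u i t + D * q ^+ i)).
have hu n t : `|h t - u n t| <= D * q ^+ n.
  by apply: (@geometric_inf_limit _ (u ^~ t) _ _ q01) => i; exact: step.
have ch : continuous h.
  apply: (@continuous_geometric_limit _ u h _ _ q01) hu => n.
  by have [_ []] := du n.
(* Sign and mass pass to the limit because each can fail by at most D q^n for every n. *)
have dh : density h.
  split=> //.
  - move=> t; rewrite -oppr_le0; apply: (le0_geometric q D _ q01) => n.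
    have [_ [_ /(_ t) u0 _]] := du n; have := hu n t.
    by rewrite ler_norml => /andP[? ?]; lra.
  - apply/eqP; rewrite -subr_eq0 -normr_le0.
    apply: (le0_geometric q D _ q01) => n.
    have [_ [cu _ <-]] := du n; rewrite -int01B//.
    apply: le_norm_int01 => // t.
    by apply: cvgB; [exact: ch|exact: cu].
exists h => //; apply/funext => t; apply/eqP.
(* Both N h - N u_n and h - u_(n+1) are at most q D q^n, hence at most D q^n; together they account
   for the 2. *)
rewrite -subr_eq0 -normr_le0; apply: (le0_geometric q (2 * D) _ q01) => n.
have -> : normalized h t - h t =
    (normalized h t - normalized (u n) t) - (h t - u n.+1 t).
  rewrite -[u n.+1 t]/(normalized (u n) t).
  by move: (normalized (u n) t) (normalized h t) (h t) => a b c; ring.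
apply: (le_trans (ler_normB _ _)).
have contr := normalized_contraction _ _ _ dh (du n).2 (hu n) t.
apply: (le_trans (lerD contr (hu n.+1 t))).
have -> : D * q ^+ n.+1 = q * (D * q ^+ n) by rewrite exprS mulrCA.
rewrite -mulrA mulr_natl mulr2n.
have Dq0 : 0 <= D * q ^+ n.
  exact: mulr_ge0 D0 (exprn_ge0 n contraction_factor_ge0).
by apply: lerD; exact: ler_piMl Dq0 (ltW q_lt1).
Qed.

(** * Rescaling between fixed densities and fixed points of the quadratic operator *)

Lemma quadZ c f t : continuous f -> quad (fun x => c * f x) t = c ^+ 2 * quad f t.
Proof.
move=> cf; rewrite /quad -int01Zl; last exact: continuous_quad_integrand.
congr int01; apply/funext => u; rewrite /inner_int.
have -> : (fun s => c * f s * k t s u) = (fun s => c * (f s * k t s u)).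
  by apply/funext => s; rewrite mulrA.
rewrite int01Zl; last exact: continuous_weighted_k2.
by ring.
Qed.

(** With I the mass of [quad h], the fixed density satisfies quad h = I h, so by homogeneity of
    degree two quad (h/I) = I^-2 (I h) = h/I. *)
Lemma quad_fixed_exists : exists f, [/\ continuous f, forall t, 0 <= f t,
  0 < int01 f & quad f = f].
Proof.
have [h dh hh] := normalized_fixed_exists; have [ch h0 h1] := dh.
have /andP[I0 _] := int01_quad_bounds _ dh.
have I_gt0 := lt_le_trans m_gt0 I0.
exists (fun t => (int01 (quad h))^-1 * h t); split.
- by move=> t; apply: cvgM; [exact: cvg_cst|exact: ch].
- by move=> t; rewrite mulr_ge0// invr_ge0 ltW.
- by rewrite int01Zl// h1 mulr1 invr_gt0.
- apply/funext => t; rewrite quadZ//.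
  have ht : h t = quad h t / int01 (quad h) by rewrite -{1}hh.
  by rewrite ht expr2 -mulrA [quad h t / _]mulrC.
Qed.

(** Take h = f/I with I the mass of [f]: then quad h = I^-2 f has mass I^-1. The scalar recovering
    [f] depends on [h] alone, so uniqueness of [h] gives uniqueness of [f]. *)
Lemma quad_fixed_normalize f : continuous f -> (forall t, 0 <= f t) ->
  0 < int01 f -> quad f = f ->
  exists2 h, density h /\ normalized h = h & forall t, f t = h t / int01 (quad h).
Proof.
move=> cf f0 I_gt0 ff; set I := int01 f in I_gt0.
have I_neq0 : I != 0 by rewrite gt_eqF.
pose h t := I^-1 * f t.
have qh : quad h = fun t => I ^- 2 * f t.
  by apply/funext => t; rewrite quadZ// ff exprVn.
have iqh : int01 (quad h) = I^-1.
  by rewrite qh int01Zl// -/I; field.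
exists h; last by move=> t; rewrite iqh /h invrK mulrAC mulVf ?mul1r.
split; first split.
- by move=> t; apply: cvgM; [exact: cvg_cst|exact: cf].
- by move=> t; rewrite mulr_ge0// invr_ge0 ltW.
- by rewrite int01Zl// mulVf.
- by apply/funext => t; rewrite /normalized iqh qh /h; field.
Qed.

Lemma quad_fixed_unique f g : continuous f -> continuous g ->
  (forall t, 0 <= f t) -> (forall t, 0 <= g t) ->
  0 < int01 f -> 0 < int01 g -> quad f = f -> quad g = g -> f = g.
Proof.
move=> cf cg f0 g0 If Ig ff gg.
have [h [dh hh] fE] := quad_fixed_normalize _ cf f0 If ff.
have [h' [dh' hh'] gE] := quad_fixed_normalize _ cg g0 Ig gg.
have hE := normalized_fixed_unique _ _ dh dh' hh hh'.
by apply/funext => t; rewrite fE gE hE.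
Qed.

(** If the mass were 0, the bounds on the kernel would squeeze the inner integral between 0 and 0,
    so [quad f], and with it [f], would vanish everywhere. *)
Lemma quad_fixed_int_gt0 f t : continuous f -> (forall t, 0 <= f t) ->
  quad f = f -> f t != 0 -> 0 < int01 f.
Proof.
move=> cf f0 ff; apply: contraNT; rewrite -leNgt => If.
have I0 : int01 f = 0.
  apply/le_anti; rewrite If /= -[leLHS](int01_cst 0).
  by apply: le_int01 => // x; exact: cvg_cst.
have inner0 u : inner_int f t u = 0.
  have := int01_weighted_bounds (fun s => k t s u) f m M.
  rewrite I0 !mulr0 => /(_ (k_cont2 t u) cf f0 (fun s => k_bounds t s u)).
  by move/le_anti.
rewrite -ff /quad; under [fun _ => _]funext => u do rewrite inner0 mulr0.
by rewrite int01_cst.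
Qed.

End QuadraticOperator.

(* Composing K and f with the retraction of R onto [0, 1] makes them continuous
   and bounded on the whole line without changing the operator on [0, 1]. *)
Section Clamp.
Context {R : realType}.

Definition clamp (x : R) : R := Num.max 0 (Num.min 1 x).

Lemma clamp_I01 x : I01 (clamp x).
Proof.
by rewrite /I01 /clamp /= in_itv /= le_max lexx ge_max ler01 ge_min lexx.
Qed.

Lemma clamp_id x : I01 x -> clamp x = x.
Proof.
rewrite /I01 /clamp /= in_itv /= => /andP[x0 x1].
by rewrite (min_idPr x1) (max_idPr x0).
Qed.

Lemma continuous_clamp : continuous clamp.
Proof.
move=> x; apply: continuous_max; first exact: cvg_cst.
by apply: continuous_min; [exact: cvg_cst|exact: cvg_id].
Qed.

(** Since [c] takes all its values in [A], restricting neighbourhoods to [A] loses nothing along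
    [c]. *)
Lemma continuous_within_comp (T U V : topologicalType) (A : set U)
    (f : U -> V) (c : T -> U) : {within A, continuous f} -> continuous c ->
  (forall x, A (c x)) -> continuous (f \o c).
Proof.
move=> /subspace_continuousP cf cc Ac x.
apply: cvg_comp (cf _ (Ac x)) => P; rewrite /within /= => near_P.
apply: (@filterS _ (nbhs x) _ (c @^-1` [set y | A y -> P y])) (cc x _ near_P).
by move=> y; apply; exact: Ac.
Qed.

Lemma continuous_triple (x y z : R -> R) : continuous x -> continuous y ->
  continuous z -> continuous (fun t => (x t, y t, z t)).
Proof. by move=> cx cy cz t; exact: cvg_pair (cvg_pair (cx t) (cy t)) (cz t). Qed.

Lemma continuous_clamp_comp (f : R -> R) : C01 f -> continuous (f \o clamp).
Proof.
by move=> cf; apply: continuous_within_comp cf continuous_clamp clamp_I01.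
Qed.

End Clamp.

(** * The Lyapunov operator as a quadratic operator *)

Lemma lyapunov_quad (R : realType) (K : R * R * R -> R) (f : R -> R) t :
  continuous f -> (forall t u, continuous (fun s => K (clamp t, clamp s, clamp u))) ->
  I01 t ->
  lyapunov K f t = quad (fun t s u => K (clamp t, clamp s, clamp u)) f t.
Proof.
(* The factor [f u] is constant in [s] and leaves the inner integral; on [0,1] the clamps are
   identities. *)
move=> cf cK tI; apply: eq_int01 => u uI; rewrite mulrC -int01Zr.
  by apply: eq_int01 => s sI; rewrite !clamp_id// [f s * _]mulrC.
by move=> s; apply: cvgM; [exact: cf|exact: cK].
Qed.

Lemma eq_lyapunov (R : realType) (K : R * R * R -> R) (f g : R -> R) t :
  (forall x, I01 x -> f x = g x) -> lyapunov K f t = lyapunov K g t.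
Proof.
move=> fg; apply: eq_int01 => u uI; apply: eq_int01 => s sI.
by rewrite !fg.
Qed.

(** * The condition on c and the extrema of the kernel *)

Lemma sqr_lt_3half (R : realType) (c : R) : 1 < c ->
  c < 2^-1 * Num.sqrt (Num.sqrt 17 + 1) -> 2 * c ^+ 2 < 3.
Proof.
move=> c1; set x := Num.sqrt 17 + 1 => cx.
(* Since sqrt 17 < 5, c^2 < x/4 < 6/4. *)
have x6 : x < 6.
  have : Num.sqrt 17 < Num.sqrt (5 ^+ 2) :> R by rewrite ltr_sqrt; lra.
  by rewrite sqrtr_sqr ger0_norm ?ler0n// /x; lra.
have x0 : 0 <= x by rewrite addr_ge0// sqrtr_ge0.
have : c ^+ 2 < (2^-1 * Num.sqrt x) ^+ 2.
  by rewrite ltr_pXn2r// nnegrE; lra.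
by rewrite exprMn sqr_sqrtr//; lra.
Qed.

(** The numerator is 2 M^2 - 2 m^2, and 2 M^2 < 2 c^2 m^2 < 3 m^2. *)
Lemma contraction_factor_lt1 (R : realType) (c m M : R) : 0 < m -> m <= M ->
  M < c * m -> 2 * c ^+ 2 < 3 -> contraction_factor m M < 1.
Proof.
move=> m0 mM Mcm c3; rewrite /contraction_factor ltr_pdivrMr ?exprn_gt0// mul1r.
have MM : M ^+ 2 < c ^+ 2 * m ^+ 2.
  by rewrite -exprMn ltr_pXn2r// nnegrE; lra.
have : 2 * c ^+ 2 * m ^+ 2 < 3 * m ^+ 2 by rewrite ltr_pM2r ?exprn_gt0.
have -> : 2 * (M - m) * (M + m) = 2 * M ^+ 2 - 2 * m ^+ 2 by ring.
by lra.
Qed.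

(** Compactness of the cube makes the image bounded, so that [inf] and [sup] are genuine bounds and
    not default values. *)
Lemma kernel_bounds (R : realType) (K : R * R * R -> R) (c : R) : 1 < c ->
  {within cube, continuous K} -> (forall p, 0 < K p) ->
  sup (K @` cube) < c * inf (K @` cube) ->
  0 < inf (K @` cube) /\
  forall p, cube p -> inf (K @` cube) <= K p <= sup (K @` cube).
Proof.
move=> c1 cK K0 hK.
have bK : bounded_set (K @` cube).
  apply: compact_bounded; apply: continuous_compact => //.
  by do 2?apply: compact_setX; exact: segment_compact.
have ub : has_ubound (K @` cube).
  have [B [_ KB]] := bK; exists (B + 1) => y Ky.
  by apply: le_trans (ler_norm y) _; apply: (KB (B + 1)) => //; rewrite ltrDl.
have lb : has_lbound (K @` cube) by exists 0 => _ [p _ <-]; exact/ltW.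
have bnds p : cube p -> inf (K @` cube) <= K p <= sup (K @` cube).
  by move=> pc; rewrite ge_inf ?ub_le_sup//; exists p.
(* Positivity of the infimum is read off 0 < K(0,0,0) <= sup < c inf. *)
split=> //; rewrite -(pmulr_rgt0 _ (lt_trans ltr01 c1)); apply: lt_trans hK.
have c0 : cube (0 : R, 0 : R, 0 : R).
  by rewrite -(clamp_id 0); [do !split; exact: clamp_I01|
    rewrite /I01 /= in_itv /= lexx ler01].
by have /andP[_] := bnds _ c0; apply: lt_le_trans.
Qed.

(** * Existence and uniqueness for the Lyapunov operator *)

Theorem theorem3p1 (R : realType)
    (J3 J J1 alpha beta : R)
    (xi1 : R * R * R -> R) (xi2 xi3 : R * R -> R)
    (hJ3 : J3 != 0) (hbeta : 0 < beta)
    (bxi1 : [bounded xi1 p | p in cube])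
    (bxi2 : [bounded xi2 p | p in square])
    (bxi3 : [bounded xi3 p | p in square])
    (mxi1 : completed_measurable_fun lebesgue3 (cube) xi1)
    (mxi2 : completed_measurable_fun lebesgue2 (square) xi2)
    (mxi3 : completed_measurable_fun lebesgue2 (square) xi3)
    (K : R * R * R -> R)
    (defK : K = kernelK J3 J J1 alpha beta xi1 xi2 xi3)
    (cK : {within cube, continuous K})
    (c : R) (hc1 : 1 < c)
    (hc2 : c < 2^-1 * Num.sqrt (Num.sqrt 17 + 1))
    (hK : sup (K @` cube) < c * inf (K @` cube)) :
  exists f : R -> R,
    [/\ C01_nonneg_nonzero f,
        lyapunov_fixed K f
      & forall g : R -> R, C01_nonneg_nonzero g -> lyapunov_fixed K g ->
          forall t, I01 t -> g t = f t].
Proof.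
have K0 p : 0 < K p by rewrite defK; case: p => [[t s] u]; exact: expR_gt0.
have [m0 Kb] := kernel_bounds _ _ _ hc1 cK K0 hK.
move: (inf _) (sup _) m0 Kb hK => m M m0 Kb hK {K0 defK}.
pose k t s u := K (clamp t, clamp s, clamp u).
have kb t s u : m <= k t s u <= M.
  by apply: Kb; do !split; exact: clamp_I01.
have kc (z : R -> R * R * R) : continuous z -> (forall x, cube (z x)) ->
    continuous (K \o z) by exact: continuous_within_comp.
have cube_clamp t s u : cube (clamp t, clamp s, clamp u).
  by do !split; exact: clamp_I01.
have k1 s u : continuous (fun t => k t s u).
  apply: (kc (fun t => (clamp t, clamp s, clamp u))) => //.
  by apply: continuous_triple => //; try exact: continuous_clamp; exact: cst_continuous.
have k2 t u : continuous (fun s => k t s u).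
  apply: (kc (fun s => (clamp t, clamp s, clamp u))) => //.
  by apply: continuous_triple => //; try exact: continuous_clamp; exact: cst_continuous.
have k3 t s : continuous (k t s).
  apply: (kc (fun u => (clamp t, clamp s, clamp u))) => //.
  by apply: continuous_triple => //; try exact: continuous_clamp; exact: cst_continuous.
have mM : m <= M by have /andP[] := kb 0 0 0; exact: le_trans.
have q1 := contraction_factor_lt1 _ _ _ _ m0 mM hK (sqr_lt_3half _ _ hc1 hc2).
have [f [cf f0 If ff]] := quad_fixed_exists _ _ _ k1 k2 k3 m0 kb q1.
exists f; split.
- split; first by split=> //; exact: continuous_subspaceT.
  by move=> fI0; move: If; rewrite (eq_int01 f (fun=> 0)) ?int01_cst ?ltxx.
- by move=> t tI; rewrite lyapunov_quad// -/k ff.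
move=> g [[cg g0] gn0] gg t tI.
have cG := continuous_clamp_comp _ cg.
have G0 x : 0 <= (g \o clamp) x by apply: g0; exact: clamp_I01.
(* The equation holds on the whole line: [k] sees its first argument only through the idempotent
   [clamp], so at [x] it is the equation at [clamp x]. *)
have GG : quad k (g \o clamp) = g \o clamp.
  apply/funext => x.
  rewrite /= -(gg _ (clamp_I01 x)) (eq_lyapunov _ _ _ (g \o clamp)).
    rewrite (lyapunov_quad _ _ _ _ cG k2 (clamp_I01 x)) /quad /inner_int.
    by rewrite /k (clamp_id _ (clamp_I01 x)).
  by move=> y yI; rewrite /= clamp_id.
have IG : 0 < int01 (g \o clamp).
  have /existsNP[x /not_implyP[xI /eqP gx]] := gn0.
  by apply: (quad_fixed_int_gt0 _ _ _ k2 kb _ x cG G0 GG); rewrite /= clamp_id.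
have -> : f = g \o clamp.
  exact: (quad_fixed_unique _ _ _ k1 k2 k3 m0 kb q1 _ _ cf cG f0 G0 If IG ff GG).
by rewrite /= clamp_id.
Qed.
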